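(* Let $P\in\mathcal{M}^+$ with density $p$, and let $c>0$ be the constant determined by $$c=\left(\frac{\mu(\gamma_n)}{\mu(p)}\right)^{1/n}.$$ If $\phi\in\Phi$, then $$\widetilde{G}_\phi^{orlicz}(P)\ge\widetilde{\Omega}_\phi^{orlicz}(P)\ge\widetilde{\Omega}_\phi^{orlicz}(\gamma_n\circ c)=\widetilde{G}_\phi^{orlicz}(\gamma_n\circ c).$$ If $\phi\in\Psi$, the same holds with each ''$\ge$'' replaced by ''$\le$''.
   Context: The underlying space is $\mathbb{R}^n$ with Lebesgue measure; for a nonnegative measurable function $p$ write $\mu(p)=\int_{\mathbb{R}^n}p(x)\,dx$. $\mathcal{F}^+$ is the set of positive real-valued measurable functions on $\mathbb{R}^n$, and $\mathcal{M}^+$ is the set of finite measures on $\mathbb{R}^n$ having a density (with respect to Lebesgue measure) in $\mathcal{F}^+$. Let $\gamma_n(x)=e^{-\|x\|_2^2/2}$ with $\|\cdot\|_2$ the Euclidean norm, and for $c>0$ let $(\gamma_n\circ c)(x)=\gamma_n(cx)$; when a functional of measures is applied to $\gamma_n\circ c$, this means the measure with density $\gamma_n\circ c$. For $p\in\mathcal{F}^+$, its polar dual function is $p^\circ(y)=\inf_{x\in\mathbb{R}^n}\frac{e^{-\langle x,y\rangle}}{p(x)}$. Let $\mathcal{D}=\{p\in\mathcal{F}^+:\mu(p)\mu(p^\circ)\le[\mu(\gamma_n)]^2\}$, where $\mu(\gamma_n)^2=(2\pi)^n$, and let $\mathcal{L}_c$ be the set of log-concave functions on $\mathbb{R}^n$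 (functions of the form $e^{-\psi}$ with $\psi$ convex). Writing $Q\in\mathcal{D}$ (resp. $Q\in\mathcal{D}\cap\mathcal{L}_c$) for a finite measure $Q$ means that its density $q$ belongs to $\mathcal{D}$ (resp. $\mathcal{D}\cap\mathcal{L}_c$). $\Phi$ is the set of functions $\phi:(0,\infty)\to(0,\infty)$ that are decreasing and strictly convex; $\Psi$ is the set of functions $\phi:(0,\infty)\to(0,\infty)$ that are increasing and strictly concave. For measures $P,Q$ with densities $p,q$ and a constant $a\ge 0$, $D_\phi(aQ,P)=\int_{\mathbb{R}^n}\phi\left(\frac{a\,q(x)}{p(x)}\right)p(x)\,dx$, with the convention $\phi(0)=\lim_{t\to0^+}\phi(t)\in[0,\infty]$. For $P\in\mathcal{M}^+$ the dual functional Orlicz affine surface area is $$\widetilde{\Omega}_\phi^{orlicz}(P)=\inf_{Q\in\mathcal{D}}D_\phi\left(\frac{\mu(q^\circ)}{\mu(\gamma_n)}Q,P\right)\ \text{ if }\phi\in\Phi,$$ and it is defined by the same formula with $\inf$ replaced by $\sup$ if $\phi\in\Psi$. The dual functional Orlicz geominimal surface area $\widetilde{G}_\phi^{orlicz}(P)$ is defined in the same way with $\mathcal{D}$ replaced by $\mathcal{D}\cap\mathcal{L}_c$. *)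

(* Defs.v *)
From HB Require Import structures.
From mathcomp Require Import all_boot all_order all_algebra.
From mathcomp Require Import all_classical all_reals all_analysis.

Set Implicit Arguments.
Unset Strict Implicit.
Unset Printing Implicit Defensive.

Import Order.TTheory GRing.Theory Num.Theory.
Import numFieldNormedType.Exports.

Local Open Scope classical_set_scope.
Local Open Scope ring_scope.

Definition measure_rV_display : measure_display -> measure_display.
Proof. exact. Qed.

(* The sigma-algebra on 'rV[T]_n generated by the n coordinates; for T = R it
   is the Borel sigma-algebra of R^n. *)
Section measurable_rV.
Context {d} {T : sigmaRingType d}.
Variable n : nat.

Let coors : 'I_n -> 'rV[T]_n -> T := fun i x => x ord0 i.

Let rV_set0 : g_sigma_preimage coors set0.
Proof. exact: sigma_algebra0. Qed.

Let rV_setC A : g_sigma_preimage coors A -> g_sigma_preimage coors (~` A).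
Proof. exact: sigma_algebraC. Qed.

Let rV_bigcup (F : _^nat) : (forall i, g_sigma_preimage coors (F i)) ->
  g_sigma_preimage coors (\bigcup_i (F i)).
Proof. exact: sigma_algebra_bigcup. Qed.

HB.instance Definition _ := @isMeasurable.Build (measure_rV_display d)
  'rV[T]_n (g_sigma_preimage coors) rV_set0 rV_setC rV_bigcup.

End measurable_rV.

Lemma measurable_coord d (T : sigmaRingType d) n (i : 'I_n) :
  measurable_fun [set: 'rV[T]_n] (fun x : 'rV[T]_n => x ord0 i).
Proof.
move=> _ Y mY; rewrite setTI; apply: sub_sigma_algebra => /=.
rewrite -bigcup_seq/=; exists i => /=; first by rewrite mem_index_enum.
by exists Y => //; rewrite setTI.
Qed.

Lemma measurable_fun_coordP d1 d2 (T1 : measurableType d1)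
    (T2 : measurableType d2) n (f : T1 -> 'rV[T2]_n) :
  measurable_fun [set: T1] f <->
  forall i, measurable_fun [set: T1] (fun x => f x ord0 i).
Proof.
split=> [mf i|mf].
  exact: (measurableT_comp (@measurable_coord _ _ _ i) mf).
move=> _ A mA; rewrite setTI.
suff : measurable `<=` [set B : set 'rV[T2]_n | measurable (f @^-1` B)] by exact.
apply: smallest_sub.
  split => /=.
  - by rewrite preimage_set0.
  - move=> B mB; rewrite setTD preimage_setC; exact: measurableC.
  - by move=> F mF; rewrite preimage_bigcup; exact: bigcup_measurable.
rewrite -bigcup_seq/= => _ [i _ [B mB <-]] /=.
by rewrite setTI; have := mf i measurableT B mB; rewrite setTI.
Qed.

(* 1 + n is convertible to n.+1, so this is the identification of R x R^n with
   R^(n+1). *)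
Definition rV_cons (T : Type) n (x : T * 'rV[T]_n) : 'rV[T]_n.+1 :=
  row_mx (const_mx x.1 : 'rV_1) x.2.

Definition rV_uncons (T : Type) n (v : 'rV[T]_n.+1) : T * 'rV[T]_n :=
  (v ord0 ord0, rsubmx (v : 'rV_(1 + n))).

Lemma rV_consK (T : Type) n : cancel (@rV_cons T n) (@rV_uncons T n).
Proof.
move=> [a v]; rewrite /rV_cons /rV_uncons row_mxKr; congr pair.
have /esym := row_mxEl (const_mx a : 'rV_1) v ord0 ord0.
rewrite mxE => aE; rewrite [RHS]aE /=.
by congr (fun_of_matrix (row_mx _ _) _ _); apply/val_inj.
Qed.

Lemma measurable_rV_cons d (T : measurableType d) n :
  measurable_fun setT (@rV_cons T n).
Proof.
apply/measurable_fun_coordP => i; rewrite /rV_cons.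
case: (@split_ordP 1 n i) => j ->.
- rewrite (_ : (fun _ => _) = fst)//.
  by apply/funext => x; apply: etrans (row_mxEl _ _ _ _) _; rewrite mxE.
- rewrite (_ : (fun _ => _) = (fun v : 'rV[T]_n => v ord0 j) \o snd); last first.
    by apply/funext => x; exact: row_mxEr.
  exact: (measurableT_comp (@measurable_coord _ _ _ j) measurable_snd).
Qed.

Lemma measurable_rV_uncons d (T : measurableType d) n :
  measurable_fun setT (@rV_uncons T n).
Proof.
apply/measurable_fun_pairP; split; first exact: measurable_coord.
apply/measurable_fun_coordP => i /=.
rewrite (_ : (fun _ => _) =
  fun v : 'rV[T]_n.+1 => v ord0 (rshift 1 i : 'I_n.+1)); last first.
  by apply/funext => v; rewrite /= mxE.
exact: measurable_coord.
Qed.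

Section lebesgue_rV.
Context {R : realType}.

Section step.
Variables (n : nat) (m : {sigma_finite_measure set 'rV[R]_n -> \bar R}).

Let prod : {measure set (measurableTypeR R * 'rV[R]_n) -> \bar R} :=
  (@lebesgue_measure R \x m)%E.

Let cons : measurableTypeR R * 'rV[R]_n -> 'rV[R]_n.+1 := @rV_cons R n.

Let mcons : measurable_fun setT cons := @measurable_rV_cons _ R n.

Let uncons : 'rV[R]_n.+1 -> measurableTypeR R * 'rV[R]_n := @rV_uncons R n.

Let muncons : measurable_fun setT uncons := @measurable_rV_uncons _ R n.

Definition lebesgue_rV_step : set 'rV[R]_n.+1 -> \bar R :=
  pushforward (@lebesgue_measure R \x m)%E
    (@rV_cons R n : measurableTypeR R * 'rV[R]_n -> 'rV[R]_n.+1).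

Let step0 : lebesgue_rV_step set0 = 0%E.
Proof. by rewrite /lebesgue_rV_step /pushforward preimage_set0 measure0. Qed.

Let step_ge0 A : (0 <= lebesgue_rV_step A)%E.
Proof. exact: measure_ge0. Qed.

Let step_additive : semi_sigma_additive lebesgue_rV_step.
Proof.
move=> F mF tF mUF; rewrite /lebesgue_rV_step /pushforward preimage_bigcup.
have mpre A : measurable A -> measurable (cons @^-1` A).
  by move=> mA; rewrite -[X in measurable X]setTI; exact: mcons.
apply: measure_semi_sigma_additive.
- by move=> k; exact: mpre.
- apply/trivIsetP => /= i j _ _ ij; rewrite -preimage_setI.
  by move/trivIsetP : tF => /(_ _ _ _ _ ij) ->//; rewrite preimage_set0.
- by rewrite -preimage_bigcup; exact: mpre.
Qed.

HB.instance Definition _ := isMeasure.Build _ _ _ lebesgue_rV_step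
  step0 step_ge0 step_additive.

Let step_sigma_finite : sigma_finite setT lebesgue_rV_step.
Proof.
have /sigma_finiteP[F [TF ndF mF]] := sigma_finiteT (@lebesgue_measure R).
have /sigma_finiteP[G [TG ndG mG]] := sigma_finiteT m.
exists (fun k => uncons @^-1` (F k `*` G k)).
  apply/seteqP; split=> // v _.
  have [i _ Fi] : (\bigcup_i F i) (rV_uncons v).1 by rewrite -TF.
  have [j _ Gj] : (\bigcup_j G j) (rV_uncons v).2 by rewrite -TG.
  exists (maxn i j) => //; split.
    by have /subsetPset := ndF _ _ (leq_maxl i j); exact.
  by have /subsetPset := ndG _ _ (leq_maxr i j); exact.
move=> k; have [[mFk Fk] [mGk Gk]] := (mF k, mG k).
split.
  rewrite -[X in measurable X]setTI; apply: muncons => //.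
  exact: measurableX.
rewrite /lebesgue_rV_step /pushforward -comp_preimage.
rewrite (_ : _ \o _ = id); last by apply/funext; exact: rV_consK.
rewrite preimage_id (_ : prod _ = @lebesgue_measure R (F k) * m (G k))%E.
  by rewrite lte_mul_pinfty// ge0_fin_numE.
exact: product_measure1E.
Qed.

HB.instance Definition _ := Measure_isSigmaFinite.Build _ _ _
  lebesgue_rV_step step_sigma_finite.

End step.

(* The n-fold product of the Lebesgue measure on R. *)
Fixpoint lebesgue_rV n : {sigma_finite_measure set 'rV[R]_n -> \bar R} :=
  if n is n'.+1 then lebesgue_rV_step (lebesgue_rV n')
  else \d_(0 : 'rV[R]_0).

End lebesgue_rV.

Section functionals.
Context {R : realType} {n : nat}.
Implicit Types (p q : 'rV[R]_n -> R) (x y : 'rV[R]_n) (phi : R -> R).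

Local Notation leb := (@lebesgue_rV R n).

Definition dot x y : R := \sum_(i < n) x ord0 i * y ord0 i.

Definition enorm x : R := Num.sqrt (dot x x).

Definition mass p : \bar R := (\int[leb]_x (p x)%:E)%E.

Definition gauss x : R := expR (- (enorm x ^+ 2 / 2)).

Definition gauss_scale (c : R) x : R := gauss (c *: x).

Definition Fplus : set ('rV[R]_n -> R) :=
  [set p : 'rV[R]_n -> R | measurable_fun setT p /\ forall x, 0 < p x].

Definition with_density p : set 'rV[R]_n -> \bar R :=
  fun A => (\int[leb]_(x in A) (p x)%:E)%E.

(* For a finite measure P, this says that P belongs to M^+ with density p. *)
Definition has_density (P : set 'rV[R]_n -> \bar R) p :=
  Fplus p /\ forall A, measurable A -> P A = with_density p A.

(* The infimum is over a nonempty set of positive reals when p is positive. *)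
Definition polar p y : R := inf (range (fun x => expR (- dot x y) / p x)).

Definition Dset : set ('rV[R]_n -> R) :=
  [set p : 'rV[R]_n -> R |
    Fplus p /\ (mass p * mass (polar p) <= mass gauss ^+ 2)%E].

(* psi is real-valued: log-concave functions with zeros (psi = +oo somewhere)
   are left out, but they are not in Fplus anyway. *)
Definition log_concave : set ('rV[R]_n -> R) :=
  [set f | exists2 psi : 'rV[R]_n -> R,
     @convex_function R 'rV[R]_n setT psi & f = fun x => expR (- psi x)].

(* Only the restriction of phi to ]0, +oo[ matters. Given strict convexity
   (resp. concavity), weak and strict monotonicity are equivalent. *)
Definition PhiC phi := [/\
  forall t, 0 < t -> 0 < phi t,
  {in `]0, +oo[ &, nonincreasing_fun phi} &
  forall s t l, 0 < s -> 0 < t -> s != t -> 0 < l < 1 ->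
    phi (l * s + (1 - l) * t) < l * phi s + (1 - l) * phi t].

Definition PsiC phi := [/\
  forall t, 0 < t -> 0 < phi t,
  {in `]0, +oo[ &, nondecreasing_fun phi} &
  forall s t l, 0 < s -> 0 < t -> s != t -> 0 < l < 1 ->
    l * phi s + (1 - l) * phi t < phi (l * s + (1 - l) * t)].

Definition phi_ext phi (t : R) : \bar R :=
  if 0 < t then (phi t)%:E else lim ((phi s)%:E @[s --> 0^'+]).

(* D_phi(aQ, P) for measures P, Q with respective densities p, q. *)
Definition Dphi phi (a : R) q p : \bar R :=
  (\int[leb]_x (phi_ext phi (a * q x / p x) * (p x)%:E))%E.

(* The values D_phi((mass (polar q) / mass gauss) Q, P) for Q in M^+ with density
   q in K. The polar depends on q pointwise, so the pair (Q, q) is quantified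
   over. The use of fine is harmless for K included in Dset: Q being finite and
   nonzero, mass (polar q) is finite. *)
Definition orlicz_values phi (K : set ('rV[R]_n -> R))
    (P : set 'rV[R]_n -> \bar R) : set \bar R :=
  [set v | exists p q (Q : {finite_measure set 'rV[R]_n -> \bar R}),
    [/\ has_density P p, has_density Q q, K q &
        v = Dphi phi (fine (mass (polar q)) / fine (mass gauss)) q p]].

(* Only used for phi in PhiC (infimum) or in PsiC (supremum); the two classes
   are disjoint. *)
Definition orlicz_area phi K P : \bar R :=
  if `[< PhiC phi >] then ereal_inf (orlicz_values phi K P)
  else ereal_sup (orlicz_values phi K P).

Definition Omega_orlicz phi P := orlicz_area phi Dset P.

Definition G_orlicz phi P := orlicz_area phi (Dset `&` log_concave) P.

End functionals.

(* Main.v *)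
Require Import Defs.
From HB Require Import structures.
From mathcomp Require Import all_boot all_order all_algebra.
From mathcomp Require Import all_classical all_reals all_analysis.
From mathcomp Require Import measurable_realfun ring lra.

Set Implicit Arguments.
Unset Strict Implicit.
Unset Printing Implicit Defensive.

Import Order.TTheory GRing.Theory Num.Theory.
Import numFieldNormedType.Exports.

Local Open Scope classical_set_scope.
Local Open Scope ring_scope.

(** Write g for the mass of the Gaussian and m for the mass of P.  For Q in the
    class D with density q, put a = mu(q°) / g; the Santalo-type inequality that
    defines D says exactly that a mu(q) <= g.  By Jensen, for phi decreasing and
    convex,
<<
      D_phi(aQ, P) >= m phi (a mu(q) / m) >= m phi (g / m),
>>
    a bound that depends on P through its mass only.  Jensen is used in the form
    of a supporting line of slope k <= 0 at t0 = g / m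
    ([PhiC_supporting_line]): integrating
    phi (a q / p) p >= (phi t0 - k t0) p + k a q gives
    m phi t0 + k (a mu(q) - g) >= m phi t0, which also covers a = 0, where phi
    is replaced by its limit at 0+ ([Dphi_ge]).  For phi increasing and concave
    the inequalities are reversed ([Dphi_le]).

    The number c is chosen so that gamma o c has mass m, hence the same bound
    holds for it.  There the bound is attained by q = gamma o c itself, which is
    log-concave: its polar is gamma o c^-1, of mass c^n g, so that q lies in D
    with equality and a q / p is the constant c^n = g / m
    ([orlicz_values_gauss_scale]).  So both functionals take the value
    m phi (g / m) at gamma o c, the extremal value over all measures of mass m.
    The comparison of the two functionals at P is the inclusion of their
    index sets. *)

(** * Supporting lines of convex functions *)

(** The slope is the supremum of the slopes of the chords that end at t0, which
    the slopes of the chords that start at t0 bound from above. *)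
Lemma convex_supporting_line (R : realType) (f : R -> R) (t0 : R) :
  0 < t0 -> {in `]0, +oo[ &, nonincreasing_fun f} ->
  (forall s t l, 0 < s -> 0 < t -> 0 < l < 1 ->
    f (l * s + (1 - l) * t) <= l * f s + (1 - l) * f t) ->
  exists2 k, k <= 0 & forall t, 0 < t -> f t0 + k * (t - t0) <= f t.
Proof.
move=> t0_gt0 fni fcvx.
(* t0 is the convex combination of s and t with weight (t - t0) / (t - s). *)
have slopes s t : 0 < s -> s < t0 -> t0 < t ->
    (f t0 - f s) / (t0 - s) <= (f t - f t0) / (t - t0).
  move=> s0 st0 t0t.
  have ts : 0 < t - s by lra.
  have := fcvx s t ((t - t0) / (t - s)) s0 (lt_trans t0_gt0 t0t).
  have -> : 1 - (t - t0) / (t - s) = (t0 - s) / (t - s) by field; rewrite gt_eqF.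
  have -> : (t - t0) / (t - s) * s + (t0 - s) / (t - s) * t = t0.
    by field; rewrite gt_eqF.
  have l01 : 0 < (t - t0) / (t - s) < 1.
    by apply/andP; split; [apply: divr_gt0; lra|rewrite ltr_pdivrMr// mul1r; lra].
  move=> /(_ l01).
  have -> : (t - t0) / (t - s) * f s + (t0 - s) / (t - s) * f t =
            ((t - t0) * f s + (t0 - s) * f t) / (t - s) by field; rewrite gt_eqF.
  rewrite ler_pdivlMr// => h.
  rewrite ler_pdivrMr ?subr_gt0// mulrAC ler_pdivlMr ?subr_gt0//; nra.
pose S := [set (f t0 - f s) / (t0 - s) | s in [set s | 0 < s < t0]].
have S0 : S !=set0.
  by exists ((f t0 - f (t0 / 2)) / (t0 - t0 / 2)), (t0 / 2) => //=; lra.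
have ubS t : t0 < t -> ubound S ((f t - f t0) / (t - t0)).
  by move=> t0t _ [s /= /andP[s0 st0] <-]; exact: slopes.
have hS : has_sup S.
  by split=> //; exists ((f (t0 + 1) - f t0) / (t0 + 1 - t0)); apply: ubS; lra.
exists (sup S).
  apply: ge_sup => // _ [s /= /andP[s0 st0] <-].
  rewrite ler_pdivrMr ?subr_gt0// mul0r subr_le0.
  by apply: fni; rewrite ?in_itv/= ?andbT// ltW.
move=> t t_gt0; have [tt0|t0t|->] := ltgtP t t0; last by rewrite subrr mulr0 addr0.
- have : (f t0 - f t) / (t0 - t) <= sup S.
    by apply: sup_upper_bound => //; exists t => //=; rewrite t_gt0.
  by rewrite ler_pdivrMr ?subr_gt0//; lra.
- have : sup S <= (f t - f t0) / (t - t0) by apply: ge_sup => //; exact: ubS.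
  by rewrite ler_pdivlMr ?subr_gt0//; lra.
Qed.

Section supporting_lines.
Context {R : realType}.
Implicit Types (phi : R -> R) (t : R).

Let affine_cvg0 (a k b : R) :
  (a + k * (s - b))%:E @[s --> 0^'+] --> (a + k * (0 - b))%:E.
Proof.
apply: cvg_EFin; first exact: nearW.
apply: cvg_at_right_filter; apply: cvgD; first exact: cvg_cst.
by apply: cvgMr; apply: cvgB; [exact: cvg_id|exact: cvg_cst].
Qed.

(** At 0 the bound survives the passage to the limit; monotonicity of phi makes
    that limit exist in the extended reals, possibly as +oo. *)
Lemma phi_ext_ge_affine phi (a k b : R) : {in `]0, +oo[ &, nonincreasing_fun phi} ->
  (forall t, 0 < t -> a + k * (t - b) <= phi t) ->
  forall t, 0 <= t -> ((a + k * (t - b))%:E <= phi_ext phi t)%E.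
Proof.
move=> phi_ni le_phi t; rewrite le_eqVlt => /predU1P[<-|t0]; last first.
  by rewrite /phi_ext t0 lee_fin; exact: le_phi.
rewrite /phi_ext ltxx -(cvg_lim _ (@affine_cvg0 a k b))//; apply: lee_lim.
- by apply/cvg_ex; eexists; exact: affine_cvg0.
- apply: nonincreasing_at_right_is_cvge; near=> x => s u.
  rewrite !in_itv/= => /andP[s0 _] /andP[u0 _] su.
  by rewrite lee_fin; apply: phi_ni; rewrite ?in_itv/= ?andbT.
- near=> s; rewrite lee_fin; apply: le_phi.
  by near: s; exact: nbhs_right_gt.
Unshelve. all: by end_near. Qed.

Lemma phi_ext_le_affine phi (a k b : R) : {in `]0, +oo[ &, nondecreasing_fun phi} ->
  (forall t, 0 < t -> phi t <= a + k * (t - b)) ->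
  forall t, 0 <= t -> (phi_ext phi t <= (a + k * (t - b))%:E)%E.
Proof.
move=> phi_nd phi_le t; rewrite le_eqVlt => /predU1P[<-|t0]; last first.
  by rewrite /phi_ext t0 lee_fin; exact: phi_le.
rewrite /phi_ext ltxx -(cvg_lim _ (@affine_cvg0 a k b))//; apply: lee_lim.
- apply: nondecreasing_at_right_is_cvge; near=> x => s u.
  rewrite !in_itv/= => /andP[s0 _] /andP[u0 _] su.
  by rewrite lee_fin; apply: phi_nd; rewrite ?in_itv/= ?andbT.
- by apply/cvg_ex; eexists; exact: affine_cvg0.
- near=> s; rewrite lee_fin; apply: phi_le.
  by near: s; exact: nbhs_right_gt.
Unshelve. all: by end_near. Qed.

Lemma PhiC_supporting_line phi t0 : PhiC phi -> 0 < t0 ->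
  exists2 k, k <= 0 &
    forall t, 0 <= t -> ((phi t0 + k * (t - t0))%:E <= phi_ext phi t)%E.
Proof.
move=> [_ phi_ni phi_cvx] t0_gt0.
have [|k k0 kP] := convex_supporting_line t0_gt0 phi_ni.
  move=> s t l s0 t0' l01; have [->|st] := eqVneq s t; last exact/ltW/phi_cvx.
  by rewrite -!mulrDl addrC subrK !mul1r.
by exists k => //; exact: phi_ext_ge_affine.
Qed.

Lemma PsiC_supporting_line phi t0 : PsiC phi -> 0 < t0 ->
  exists2 k, 0 <= k &
    forall t, 0 <= t -> (phi_ext phi t <= (phi t0 + k * (t - t0))%:E)%E.
Proof.
move=> [_ phi_nd phi_ccv] t0_gt0.
have [||k k0 kP] := @convex_supporting_line R (fun t => - phi t) _ t0_gt0.
- by move=> s t sp tp st; rewrite lerN2; exact: phi_nd.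
- move=> s t l s0 t0' l01; have [->|st] := eqVneq s t.
    by rewrite -!mulrDl addrC subrK !mul1r.
  by rewrite !mulrN -opprD lerN2; exact/ltW/phi_ccv.
exists (- k); first by rewrite oppr_ge0.
apply: phi_ext_le_affine => // t t_gt0; have := kP _ t_gt0; lra.
Qed.

Lemma phi_ext_ge0_Phi phi t : PhiC phi -> 0 <= t -> (0 <= phi_ext phi t)%E.
Proof.
move=> [phi0 phi_ni _] t0.
have := @phi_ext_ge_affine phi 0 0 0 phi_ni _ t t0.
by rewrite mul0r addr0; apply => s s0; rewrite mul0r addr0 ltW ?phi0.
Qed.

Lemma phi_ext_ge0_Psi phi t : PsiC phi -> 0 <= t -> (0 <= phi_ext phi t)%E.
Proof.
move=> [phi0 phi_nd _]; rewrite le_eqVlt => /predU1P[<-|t0]; last first.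
  by rewrite /phi_ext t0 lee_fin ltW ?phi0.
rewrite /phi_ext ltxx; apply: lime_ge.
  apply: nondecreasing_at_right_is_cvge; near=> x => s u.
  rewrite !in_itv/= => /andP[s0 _] /andP[u0 _] su.
  by rewrite lee_fin; apply: phi_nd; rewrite ?in_itv/= ?andbT.
by near=> s; rewrite lee_fin ltW// phi0.
Unshelve. all: by end_near. Qed.

Lemma PsiC_not_PhiC phi : PsiC phi -> ~ PhiC phi.
Proof.
move=> [_ _ ccv] [_ _ cvx].
have h : (0 < 2^-1 :> R) && (2^-1 < 1 :> R) by apply/andP; split; lra.
have n12 : 1 != 2 :> R by rewrite lt_eqF// ltr1n.
have := cvx 1 2 _ ltr01 (ltr0Sn _ _) n12 h.
by rewrite ltNge ltW//; exact: ccv.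
Qed.

End supporting_lines.

(** * Integrals and densities *)

Section monotone_integral.
Local Open Scope ereal_scope.
Context d (T : measurableType d) (R : realType).
Variable mu : {measure set T -> \bar R}.
Implicit Types f g : T -> \bar R.

(** Neither function has to be measurable: the integral of a nonnegative function
    is a supremum over the simple functions below it.  This is what allows an
    integrand built from phi without a proof that it is measurable. *)
Lemma ge0_le_integralT f g : (forall x, 0 <= f x) -> (forall x, f x <= g x) ->
  \int[mu]_x f x <= \int[mu]_x g x.
Proof.
move=> f0 fg; have g0 x : 0 <= g x by exact: le_trans (fg x).
rewrite !ge0_integralTE//; apply: ereal_sup_le => _ [h /= hf <-].
by exists h => //= x; exact: le_trans (fg x).
Qed.

Lemma le_ge0_integralT f g : (forall x, 0 <= g x) -> (forall x, f x <= g x) ->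
  \int[mu]_x f x <= \int[mu]_x g x.
Proof.
move=> g0 fg; rewrite integralE.
apply: (@le_trans _ _ (\int[mu]_x f^\+ x)).
  by rewrite -[leRHS]sube0 leeB// integral_ge0.
apply: ge0_le_integralT => // x.
by rewrite funeposE ge_max fg g0.
Qed.

Lemma integral_affine (p q : T -> R) (A B : R) :
  mu.-integrable setT (EFin \o p) -> mu.-integrable setT (EFin \o q) ->
  \int[mu]_x (A * p x + B * q x)%:E =
  A%:E * \int[mu]_x (p x)%:E + B%:E * \int[mu]_x (q x)%:E.
Proof.
move=> ip iq; under eq_integral do rewrite EFinD !EFinM.
have iAp := integrableZl measurableT A ip.
have iBq := integrableZl measurableT B iq.
by rewrite (integralD measurableT iAp iBq)/= !integralZl.
Qed.

End monotone_integral.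

Section density_measure.
Context d (T : measurableType d) (R : realType).
Variables (mu : {measure set T -> \bar R}) (p : T -> R).
Hypotheses (mp : measurable_fun setT p) (p0 : forall x, 0 <= p x).
Hypothesis p_fin : (\int[mu]_x (p x)%:E < +oo)%E.

Let nu (A : set T) := (\int[mu]_(x in A) (p x)%:E)%E.

Let nu0 : nu set0 = 0%E. Proof. exact: integral_set0. Qed.

Let nu_ge0 A : (0 <= nu A)%E.
Proof. by apply: integral_ge0 => x _; rewrite lee_fin. Qed.

Let nu_add : semi_sigma_additive nu.
Proof.
apply: semi_sigma_additive_nng_induced => [|x]; last by rewrite lee_fin.
exact/measurable_EFinP.
Qed.

Lemma density_finite_measure :
  exists Q : {finite_measure set T -> \bar R},
    forall A, Q A = (\int[mu]_(x in A) (p x)%:E)%E.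
Proof.
pose M := isMeasure.Build _ _ _ nu nu0 nu_ge0 nu_add.
pose N : {measure set T -> \bar R} := HB.pack nu M.
have fN : fin_num_fun N by exact: lty_fin_num_fun.
pose F := Measure_isFinite.Build _ _ _ N fN.
pose Q : {finite_measure set T -> \bar R} := HB.pack nu M F.
by exists Q.
Qed.
End density_measure.

(** * Gaussian functions *)

Section gaussian.
Context {R : realType}.
Implicit Types c : R.

Lemma dot_ge0 n (x : 'rV[R]_n) : 0 <= dot x x.
Proof. by apply: sumr_ge0 => i _; rewrite -expr2 sqr_ge0. Qed.

Lemma gauss_scaleE n c (x : 'rV[R]_n) :
  gauss_scale c x = expR (- (c ^+ 2 * dot x x / 2)).
Proof.
rewrite /gauss_scale /gauss /enorm sqr_sqrtr ?dot_ge0//; congr (expR (- (_ / 2))).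
by rewrite /dot mulr_sumr; apply: eq_bigr => i _; rewrite !mxE; ring.
Qed.

Lemma gauss_scale1 n : gauss_scale 1 = @gauss R n.
Proof. by apply/funext => x; rewrite /gauss_scale scale1r. Qed.

Lemma gauss_scale_gt0 n c (x : 'rV[R]_n) : 0 < gauss_scale c x.
Proof. exact: expR_gt0. Qed.

Lemma measurable_gauss_scale n c : measurable_fun setT (@gauss_scale R n c).
Proof.
rewrite (_ : gauss_scale c = fun x => expR (- (c ^+ 2 * dot x x / 2))).
  apply: measurableT_comp => //; apply: measurableT_comp => //.
  apply: measurable_funM => //; apply: measurable_funM => //.
  apply: measurable_sum => i.
  by apply: measurable_funM; exact: measurable_coord.
by apply/funext => x; exact: gauss_scaleE.
Qed.

Lemma Fplus_gauss_scale n c : Fplus (@gauss_scale R n c).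
Proof.
by split; [exact: measurable_gauss_scale|move=> x; exact: gauss_scale_gt0].
Qed.

Lemma dot_rV_cons n (z : R * 'rV[R]_n) :
  dot (rV_cons z) (rV_cons z) = z.1 ^+ 2 + dot z.2 z.2.
Proof.
move: (rV_cons z) (rV_consK z) => v <-; rewrite /dot big_ord_recl -expr2.
congr +%R; apply: eq_bigr => i _; rewrite mxE.
by have -> : lift ord0 i = rshift 1 i by exact/val_inj.
Qed.

Lemma gauss_scale_cons n c (z : R * 'rV[R]_n) :
  gauss_scale c (rV_cons z) =
  normal_fun 0 c^-1 z.1 * gauss_scale c z.2.
Proof.
rewrite !gauss_scaleE dot_rV_cons /normal_fun -expRD; congr expR.
by rewrite subr0 exprVn -[_ ^- 2 *+ 2]mulr_natr [(_ ^- 2 * _)^-1]invfM invrK; field.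
Qed.

Lemma integral_normal_fun c : 0 < c ->
  (\int[@lebesgue_measure R]_x (normal_fun 0 c^-1 x)%:E)%E =
  (Num.sqrt (pi *+ 2) / c)%:E.
Proof.
move=> c0; have s0 : c^-1 != 0 by rewrite invr_eq0 gt_eqF.
have k0 := normal_peak_gt0 s0.
have := @integral_normal_pdf R 0 c^-1.
rewrite normal_pdfE//; under eq_integral do rewrite EFinM.
rewrite ge0_integralZl//=; last 3 first.
- by apply/measurable_EFinP; exact: measurable_normal_fun.
- by move=> x _; rewrite lee_fin normal_fun_ge0.
- by rewrite lee_fin ltW.
have -> : normal_peak c^-1 = (Num.sqrt (pi *+ 2) / c)^-1.
  rewrite /normal_peak -mulrnAr sqrtrM ?sqr_ge0// sqrtr_sqr.
  by rewrite ger0_norm 1?mulrC// invr_ge0 ltW.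
set I := integral _ _ _; set k := _ / c => kI.
have k1 : 0 < k.
  by rewrite divr_gt0// sqrtr_gt0 mulrn_wgt0// pi_gt0.
by rewrite -[LHS]mul1e -(divff (lt0r_neq0 k1)) EFinM -muleA kI mule1.
Qed.

(** Induction on n with Tonelli on R x R^n, the Gaussian being a product of
    one-dimensional Gaussians; each contributes sqrt (2 pi) / c. *)
Lemma mass_gauss_scale n c : 0 < c ->
  mass (@gauss_scale R n c) = ((Num.sqrt (pi *+ 2) / c) ^+ n)%:E.
Proof.
move=> c0; elim: n => [|n IH].
  rewrite /mass /= integral_dirac//; last first.
    by apply/measurable_EFinP; exact: measurable_gauss_scale.
  by rewrite diracT mul1e gauss_scaleE /dot big_ord0 mulr0 mul0r oppr0 expR0.
rewrite /mass /=.
have mg : measurable_fun setT (EFin \o @gauss_scale R n.+1 c).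
  by apply/measurable_EFinP; exact: measurable_gauss_scale.
pose mu : {measure set (measurableTypeR R * 'rV[R]_n) -> \bar R} :=
  (@lebesgue_measure R \x lebesgue_rV n)%E.
transitivity (\int[mu]_z (gauss_scale c (rV_cons z))%:E)%E.
  have mc : measurable_fun setT
    (@rV_cons R n : measurableTypeR R * 'rV[R]_n -> 'rV[R]_n.+1).
    exact: measurable_rV_cons.
  have := @ge0_integral_pushforward _ _ _ _ R _ mc mu setT _ measurableT mg.
  rewrite preimage_setT; apply => z _ /=; rewrite lee_fin; exact/ltW/gauss_scale_gt0.
under eq_integral do rewrite gauss_scale_cons.
have mf : measurable_fun setT (fun z : measurableTypeR R * 'rV[R]_n =>
    (normal_fun 0 c^-1 z.1 * gauss_scale c z.2)%:E).
  apply/measurable_EFinP; apply: measurable_funM.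
    by apply: measurableT_comp => //; exact: measurable_normal_fun.
  by apply: measurableT_comp => //; exact: measurable_gauss_scale.
rewrite fubini_tonelli1//=; last first.
  move=> z; rewrite lee_fin mulr_ge0 ?normal_fun_ge0//; exact/ltW/gauss_scale_gt0.
rewrite /fubini_F/=.
under eq_integral => x _.
  under eq_integral do rewrite EFinM.
  rewrite ge0_integralZl//=; last 3 first.
  - by apply/measurable_EFinP; exact: measurable_gauss_scale.
  - by move=> y _; rewrite lee_fin; exact/ltW/gauss_scale_gt0.
  - by rewrite lee_fin normal_fun_ge0.
  rewrite -/(mass _) IH muleC.
  over.
rewrite ge0_integralZl//=; last 3 first.
- by apply/measurable_EFinP; exact: measurable_normal_fun.
- by move=> x _; rewrite lee_fin normal_fun_ge0.
- by rewrite lee_fin exprn_ge0// divr_ge0// ltW.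
by rewrite integral_normal_fun// -EFinM exprSr.
Qed.

Lemma sqrt2pi_gt0 : 0 < Num.sqrt (pi *+ 2) :> R.
Proof. by rewrite sqrtr_gt0 mulrn_wgt0// pi_gt0. Qed.

Lemma mass_gauss n : mass (@gauss R n) = (Num.sqrt (pi *+ 2) ^+ n)%:E.
Proof. by rewrite -gauss_scale1 mass_gauss_scale// divr1. Qed.

(** Completing the square: c^2 |x|^2 / 2 - <x, y> is
    |c x - y / c|^2 / 2 - |y|^2 / (2 c^2), minimal at x = y / c^2. *)
Lemma polar_gauss_scale n c : 0 < c ->
  polar (@gauss_scale R n c) = gauss_scale c^-1.
Proof.
move=> c0; apply/funext => y; rewrite /polar gauss_scaleE.
have valE (x : 'rV[R]_n) : expR (- dot x y) / gauss_scale c x =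
    expR (dot (c *: x - c^-1 *: y) (c *: x - c^-1 *: y) / 2
          - c^-1 ^+ 2 * dot y y / 2).
  rewrite gauss_scaleE -expRN -expRD; congr expR.
  rewrite /dot -[LHS]addrC !mulr_sumr !mulr_suml -!sumrN -!big_split/=.
  by apply: eq_bigr => i _; rewrite !mxE; field; rewrite gt_eqF.
apply/eqP; rewrite eq_le; apply/andP; split.
- apply: ge_inf.
    exists 0 => _ [x _ <-].
    by apply: divr_ge0; apply/ltW; [exact: expR_gt0|exact: gauss_scale_gt0].
  exists (c^-1 *: (c^-1 *: y)) => //.
  rewrite valE (scalerA c) divff ?gt_eqF// scale1r subrr; congr expR.
  by rewrite /dot big1 ?mul0r ?add0r// => i _; rewrite mxE mul0r.
- apply: lb_le_inf; first by eexists; exists 0.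
  move=> _ [x _ <-]; rewrite valE ler_expR lerDr divr_ge0 ?dot_ge0//.
Qed.

Lemma gauss_scale_Dset n c : 0 < c -> Dset (@gauss_scale R n c).
Proof.
move=> c0; split; first exact: Fplus_gauss_scale.
have ci0 : 0 < c^-1 by rewrite invr_gt0.
rewrite mass_gauss polar_gauss_scale// (mass_gauss_scale n c0).
rewrite (mass_gauss_scale n ci0) -EFin_expe -EFinM lee_fin.
set k := Num.sqrt _; suff -> : (k / c) ^+ n * (k / c^-1) ^+ n = (k ^+ n) ^+ 2 by [].
rewrite -exprMn -exprM mulnC exprM; congr (_ ^+ n).
by rewrite invrK; field; rewrite gt_eqF.
Qed.

Lemma log_concave_gauss_scale n c : log_concave (@gauss_scale R n c).
Proof.
exists (fun x => c ^+ 2 * dot x x / 2); last first.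
  by apply/funext => x; exact: gauss_scaleE.
move=> t x y _ _; rewrite convRE -subr_ge0 /conv/=.
have l0 : 0 <= t%:inum :> R by [].
have l1 : 0 <= 1 - t%:inum :> R by rewrite subr_ge0.
(* The convexity gap of a quadratic form is l (1 - l) times its value at x - y. *)
set l := t%:inum in l0 l1 *.
have -> : l * (c ^+ 2 * dot x x / 2) + (1 - l) * (c ^+ 2 * dot y y / 2) -
    c ^+ 2 * dot (l *: x + (1 - l) *: y) (l *: x + (1 - l) *: y) / 2 =
    l * (1 - l) * (c ^+ 2 * dot (x - y) (x - y) / 2).
  rewrite /dot !(mulr_sumr, mulr_suml) -big_split -sumrB/=.
  by apply: eq_bigr => i _; rewrite !mxE; field.
apply: mulr_ge0; first exact: mulr_ge0.
by rewrite divr_ge0// mulr_ge0 ?sqr_ge0//; exact: dot_ge0.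
Qed.

End gaussian.

(** * Divergences over the class D *)

Section divergence.
Context {R : realType} {n : nat}.
Implicit Types (p q : 'rV[R]_n -> R) (phi : R -> R).

Lemma Fplus_integrable p (m : R) : Fplus p -> mass p = m%:E ->
  (lebesgue_rV n).-integrable setT (EFin \o p).
Proof.
move=> [mp p0] pm; apply/integrableP; split; first exact/measurable_EFinP.
under eq_integral do rewrite /= ger0_norm ?ltW//.
by rewrite -/(mass p) pm ltry.
Qed.

Lemma mass_affine p q (m b A B : R) : Fplus p -> Fplus q ->
  mass p = m%:E -> mass q = b%:E ->
  (\int[lebesgue_rV n]_x (A * p x + B * q x)%:E)%E = (A * m + B * b)%:E.
Proof.
move=> Fp Fq pm qb; rewrite (integral_affine _ _ (Fplus_integrable Fp pm)
  (Fplus_integrable Fq qb)).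
by rewrite -/(mass p) -/(mass q) pm qb.
Qed.

(** Jensen's inequality in the form that the class D needs: the slope k of the
    supporting line is nonpositive, so a bound from above on a b suffices. *)
Lemma Dphi_ge phi p q (m b a g : R) : PhiC phi -> Fplus p -> Fplus q ->
  mass p = m%:E -> mass q = b%:E -> 0 < m -> 0 <= a -> 0 < g -> a * b <= g ->
  ((m * phi (g / m))%:E <= Dphi phi a q p)%E.
Proof.
move=> Pphi Fp Fq pm qb m0 a0 g0 abg; have [_ p0] := Fp; have [_ q0] := Fq.
have [k k0 kP] := PhiC_supporting_line Pphi (divr_gt0 g0 m0).
apply: (@le_trans _ _ (\int[lebesgue_rV n]_x
    ((phi (g / m) - k * (g / m)) * p x + k * a * q x)%:E)%E).
  rewrite (mass_affine _ _ Fp Fq pm qb) lee_fin.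
  have -> : (phi (g / m) - k * (g / m)) * m + k * a * b =
            m * phi (g / m) + k * (a * b - g) by field; rewrite gt_eqF.
  by rewrite lerDl mulr_le0// subr_le0.
have r0 x : 0 <= a * q x / p x by rewrite divr_ge0 ?mulr_ge0// ltW.
apply: le_ge0_integralT => x.
  by rewrite mule_ge0 ?phi_ext_ge0_Phi// lee_fin ltW.
have -> : (phi (g / m) - k * (g / m)) * p x + k * a * q x =
          (phi (g / m) + k * (a * q x / p x - g / m)) * p x.
  by field; rewrite !gt_eqF.
rewrite EFinM; apply: lee_wpmul2r; last exact: kP.
by rewrite lee_fin ltW.
Qed.

Lemma Dphi_le phi p q (m b a g : R) : PsiC phi -> Fplus p -> Fplus q ->
  mass p = m%:E -> mass q = b%:E -> 0 < m -> 0 <= a -> 0 < g -> a * b <= g ->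
  (Dphi phi a q p <= (m * phi (g / m))%:E)%E.
Proof.
move=> Pphi Fp Fq pm qb m0 a0 g0 abg; have [_ p0] := Fp; have [_ q0] := Fq.
have [k k0 kP] := PsiC_supporting_line Pphi (divr_gt0 g0 m0).
apply: (@le_trans _ _ (\int[lebesgue_rV n]_x
    ((phi (g / m) - k * (g / m)) * p x + k * a * q x)%:E)%E); last first.
  rewrite (mass_affine _ _ Fp Fq pm qb) lee_fin.
  have -> : (phi (g / m) - k * (g / m)) * m + k * a * b =
            m * phi (g / m) + k * (a * b - g) by field; rewrite gt_eqF.
  by rewrite gerDl mulr_ge0_le0// subr_le0.
have r0 x : 0 <= a * q x / p x by rewrite divr_ge0 ?mulr_ge0// ltW.
apply: ge0_le_integralT => x.
  by rewrite mule_ge0 ?phi_ext_ge0_Psi// lee_fin ltW.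
have -> : (phi (g / m) - k * (g / m)) * p x + k * a * q x =
          (phi (g / m) + k * (a * q x / p x - g / m)) * p x.
  by field; rewrite !gt_eqF.
rewrite EFinM; apply: lee_wpmul2r; last exact: kP.
by rewrite lee_fin ltW.
Qed.

Lemma Dphi_self phi p (m a : R) : Fplus p -> mass p = m%:E -> 0 < a ->
  Dphi phi a p p = (m * phi a)%:E.
Proof.
move=> Fp pm a0; have [mp p0] := Fp; rewrite /Dphi.
under eq_integral => x _ do rewrite mulfK ?gt_eqF// /phi_ext a0.
rewrite integralZl//; last exact: Fplus_integrable pm.
by rewrite -/(mass p) pm -EFinM mulrC.
Qed.

(** The pair (a, b) collects what membership in D provides for the two bounds
    above. *)
Lemma orlicz_values_data phi (P : set 'rV[R]_n -> \bar R) (m : R) v :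
  P setT = m%:E -> orlicz_values phi Dset P v ->
  exists p q a b, [/\ Fplus p, Fplus q, mass p = m%:E, mass q = b%:E &
    [/\ 0 <= a, a * b <= fine (mass (@gauss R n)) & v = Dphi phi a q p]].
Proof.
move=> PT [p [q [Q [[Fp Pp] [Fq Qq] [_ qD] ->]]]].
have qT : mass q = Q setT by rewrite Qq.
have Qfin : Q setT \is a fin_num by exact: fin_num_measure.
set a := fine (mass (polar q)) / _.
have g0 : 0 < fine (mass (@gauss R n)).
  by rewrite mass_gauss/= exprn_gt0// sqrt2pi_gt0.
have Gfin : mass (@gauss R n) \is a fin_num by rewrite mass_gauss.
have polar0 : (0 <= mass (polar q))%E.
  apply: integral_ge0 => y _; rewrite lee_fin; apply: lb_le_inf.
    by eexists; exists 0.
  by move=> _ [x _ <-]; rewrite divr_ge0 ?expR_ge0// ltW//; apply Fq.2.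
exists p, q, a, (fine (Q setT)); split => //.
- by rewrite /mass -PT Pp.
- by rewrite qT fineK.
split=> //; first by apply: divr_ge0; [exact: fine_ge0|exact: ltW].
rewrite /a mulrAC ler_pdivrMr//.
(* If the polar had infinite mass then a = 0, as [fine] sends +oo to 0. *)
have [polar_fin|] := boolP (mass (polar q) \is a fin_num); last first.
  rewrite ge0_fin_numE// -leNgt leye_eq => /eqP ->/=.
  by rewrite mul0r mulr_ge0// ltW.
move: qD; rewrite qT -(fineK Qfin) -(fineK polar_fin) -(fineK Gfin).
by rewrite -EFin_expe -EFinM lee_fin mulrC expr2.
Qed.

(** Equality case: for q = p = gamma o c the ratio a q / p is the constant c^n. *)
Lemma orlicz_values_gauss_scale phi (m c : R) : 0 < c ->
  mass (@gauss_scale R n c) = m%:E -> c ^+ n = fine (mass (@gauss R n)) / m ->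
  orlicz_values phi (Dset `&` log_concave) (with_density (@gauss_scale R n c))
    (m * phi (fine (mass (@gauss R n)) / m))%:E.
Proof.
move=> c0 gm cE; set g := fine (mass gauss) in cE *.
have FG := @Fplus_gauss_scale R n c; have [mG G0] := FG.
have [||Q QE] := @density_finite_measure _ _ _ (@lebesgue_rV R n) _ mG.
- by move=> x; exact: ltW.
- by rewrite -/(mass _) gm ltry.
exists (gauss_scale c), (gauss_scale c), Q; split.
- by split.
- by split=> // A _; exact: QE.
- by split; [exact: gauss_scale_Dset|exact: log_concave_gauss_scale].
have g0 : 0 < g by rewrite /g mass_gauss/= exprn_gt0// sqrt2pi_gt0.
have -> : fine (mass (polar (@gauss_scale R n c))) / g = c ^+ n :> R.
  rewrite polar_gauss_scale// mass_gauss_scale ?invr_gt0// /g mass_gauss/= invrK.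
  by rewrite exprMn mulrAC divff ?mul1r// gt_eqF// exprn_gt0// sqrt2pi_gt0.
by rewrite (Dphi_self _ FG gm) ?exprn_gt0// cE.
Qed.
End divergence.

(** * Comparison with the Gaussian *)

Theorem theorem14 (R : realType) (n : nat) (n_gt0 : (0 < n)%N)
  (P : {finite_measure set 'rV[R]_n -> \bar R}) (p : 'rV[R]_n -> R)
  (Pp : has_density P p) (c : R) (c_gt0 : 0 < c)
  (cE : c = (fine (mass (@gauss R n)) / fine (mass p)) `^ (n%:R^-1))
  (phi : R -> R) :
  (PhiC phi ->
    [/\ (G_orlicz phi P >= Omega_orlicz phi P)%E,
        (Omega_orlicz phi P >=
           Omega_orlicz phi (with_density (@gauss_scale R n c)))%E &
        Omega_orlicz phi (with_density (@gauss_scale R n c)) =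
          G_orlicz phi (with_density (@gauss_scale R n c))]) /\
  (PsiC phi ->
    [/\ (G_orlicz phi P <= Omega_orlicz phi P)%E,
        (Omega_orlicz phi P <=
           Omega_orlicz phi (with_density (@gauss_scale R n c)))%E &
        Omega_orlicz phi (with_density (@gauss_scale R n c)) =
          G_orlicz phi (with_density (@gauss_scale R n c))]).
Proof.
set g := fine (mass gauss) in cE; set m := fine (mass p) in cE.
have g0 : 0 < g by rewrite /g mass_gauss/= exprn_gt0// sqrt2pi_gt0.
have [[_ p0] PE] := Pp.
have PT : P setT = m%:E.
  by rewrite /m /mass -[integral _ _ _]PE// fineK// fin_num_measure.
have m_ge0 : 0 <= m by rewrite -lee_fin -PT measure_ge0.
have n0 : n%:R != 0 :> R by rewrite pnatr_eq0 -lt0n.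
(* A zero mass would make c = 0 ^ (1 / n) vanish. *)
have m0 : 0 < m.
  rewrite lt_neqAle m_ge0 andbT; apply/eqP => mE; move: c_gt0.
  by rewrite cE -mE invr0 mulr0 powR0 ?ltxx// invr_eq0.
have cn : c ^+ n = g / m.
  have gm0 : 0 <= g / m by rewrite divr_ge0// ltW.
  by rewrite -powR_mulrn ?ltW// cE -powRrM mulVf// powRr1.
have Gm : mass (@gauss_scale R n c) = m%:E.
  rewrite mass_gauss_scale//; congr EFin.
  rewrite exprMn exprVn cn invf_div.
  have -> : Num.sqrt (pi *+ 2) ^+ n = g by rewrite /g mass_gauss.
  by field; rewrite gt_eqF.
set PG := with_density _.
have PGT : PG setT = m%:E by [].
have attained := orlicz_values_gauss_scale phi c_gt0 Gm cn.
have subD Pr : orlicz_values phi (Dset `&` log_concave) Pr `<=`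
               orlicz_values phi (@Dset R n) Pr.
  by move=> v [p' [q [Q [? ? [? _] ->]]]]; exists p', q, Q; split.
split => [Pphi|Pphi].
- have area (K : set ('rV[R]_n -> R)) : orlicz_area phi K =
      fun Pr : set 'rV[R]_n -> \bar R => ereal_inf (orlicz_values phi K Pr).
    by apply/funext => Pr; rewrite /orlicz_area asboolT.
  have lower (Pr : set 'rV[R]_n -> \bar R) : Pr setT = m%:E ->
      ((m * phi (g / m))%:E <= Omega_orlicz phi Pr)%E.
    move=> PrT; rewrite /Omega_orlicz area; apply: le_ereal_inf_tmp => v.
    move=> /(orlicz_values_data PrT)[p' [q [a [b [? ? ? ? [? ? ->]]]]]].
    by apply: (@Dphi_ge _ _ phi p' q m b).
  have OG Pr : (Omega_orlicz phi Pr <= @G_orlicz R n phi Pr)%E.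
    by rewrite /Omega_orlicz /G_orlicz !area; apply: ereal_inf_le_tmp; exact: subD.
  have upper : (G_orlicz phi PG <= (m * phi (g / m))%:E)%E.
    by rewrite /G_orlicz !area; apply: ereal_inf_lbound.
  split; first exact: OG.
  + exact: le_trans (OG _) (le_trans upper (lower _ PT)).
  + by apply/eqP; rewrite eq_le OG/= (le_trans upper)// lower.
- have area (K : set ('rV[R]_n -> R)) : orlicz_area phi K =
      fun Pr : set 'rV[R]_n -> \bar R => ereal_sup (orlicz_values phi K Pr).
    by apply/funext => Pr; rewrite /orlicz_area asboolF//; exact: PsiC_not_PhiC.
  have upper (Pr : set 'rV[R]_n -> \bar R) : Pr setT = m%:E ->
      (Omega_orlicz phi Pr <= (m * phi (g / m))%:E)%E.
    move=> PrT; rewrite /Omega_orlicz area; apply: ge_ereal_sup => v.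
    move=> /(orlicz_values_data PrT)[p' [q [a [b [? ? ? ? [? ? ->]]]]]].
    by apply: (@Dphi_le _ _ phi p' q m b).
  have GO Pr : (@G_orlicz R n phi Pr <= Omega_orlicz phi Pr)%E.
    by rewrite /Omega_orlicz /G_orlicz !area; apply: ereal_sup_le; exact: subD.
  have lower : ((m * phi (g / m))%:E <= G_orlicz phi PG)%E.
    by rewrite /G_orlicz !area; apply: ereal_sup_ubound.
  split; first exact: GO.
  + exact: le_trans (le_trans (upper _ PT) lower) (GO _).
  + by apply/eqP; rewrite eq_le GO andbT (le_trans _ lower)// upper.
Qed.
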